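(* Let $\mathcal U$ be a utility functional on $L$ that is normalized ($\mathcal U(0)=0$) and satisfies the upper Fatou property and SE. Let $\mathcal R$ be a risk functional on $L$ that is normalized ($\mathcal R(0)=0$), cash-convex and satisfies the lower Fatou property. Assume that $\mathcal U$ or $\mathcal R$ is law-invariant. Then the following statements are equivalent: (a) $\mathcal U$ satisfies SLL on $L$, or $\mathcal R$ satisfies SLL on $L$; (b) $(\mathcal U,\mathcal R)$-terminal-wealth portfolio selection is market-independent weakly well posed; (c) $(\mathcal U,\mathcal R)$-terminal-wealth portfolio selection is market-independent well posed.
   Context: Setting. $(\Omega,\mathcal F,\mathbb P)$ is an atomless probability space. $L$ is a Riesz space of random variables (vector lattice for the $\mathbb P$-a.s. order) with $L^\infty\subset L\subset L^1$, which is law-invariant: if $Y\in L$ and $Z$ is a random variable on $(\Omega,\mathcal F,\mathbb P)$ with the same law as $Y$, then $Z\in L$. Constants are identified with constant random variables. A utility functional is a map $\mathcal U:L\to[-\infty,\infty)$ that is increasing ($Y\le Z$ a.s. implies $\mathcal U(Y)\le\mathcal U(Z)$), satisfies $\mathcal U(c)\in\mathbb R$ for all constants $c>0$, and $\mathcal U(Y)<\mathcal U(\infty):=\lim_{y\to\infty}\mathcal U(y)$ for all $Y\in L$. A risk functional is a map $\mathcal R:L\to(-\infty,\infty]$ that is decreasing ($Y\le Z$ a.s. implies $\mathcal R(Y)\ge\mathcal R(Z)$) with $\mathcal R(c)\in\mathbb R$ for all constants $c>0$. Properties. Cash-convex: $\mathcal R(\lambda Y+(1-\lambda)c)\le\lambda\mathcal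 R(Y)+(1-\lambda)\mathcal R(c)$ for $\lambda\in(0,1)$, $Y\in L$, $c\in\mathbb R$. Law-invariant functional: $\mathcal H(Y)=\mathcal H(Z)$ whenever $Y,Z\in L$ have the same distribution. Upper (resp. lower) Fatou property: $\mathcal H(Y)\ge\limsup_n\mathcal H(Y_n)$ (resp. $\mathcal H(Y)\le\liminf_n\mathcal H(Y_n)$) whenever $Y_n,Y\in L$, $Y_n\to Y$ a.s. and $|Y_n|\le Z$ a.s. for all $n$, for some $Z\in L$. Large-loss notions. $\mathcal R$ satisfies SLL on $L$ if for every $Y\in L$ with $\mathbb P[Y<0]>0$ there is $\lambda_Y\in(0,\infty)$ with $\mathcal R(\lambda Y)>0$ for all $\lambda>\lambda_Y$. $\mathcal U$ satisfies SLL on $L$ if for every such $Y$ there is $\lambda_Y\in(0,\infty)$ with $\mathcal U(\lambda Y)<0$ for all $\lambda>\lambda_Y$. $\mathcal U$ satisfies ASLL on $L$ if for every such $Y$, $\limsup_{\lambda\to\infty}\mathcal U(\lambda Y)<\mathcal U(\infty)$. $\mathcal U$ satisfies SE (sensitivity equivalence) if it satisfies ASLL on $L$ if and only if it satisfies SLL on $L$. Markets. $\mathbb S(L)$ is the set of all $\bar S=(S^0_t,\dots,S^d_t)_{t\in\{0,1\}}$, with arbitrary $d\in\mathbb N$, $S^i_0=1$ for all $i$, $S^0_1=1+r$ for some $r\in(-1,\infty)$ (the risk-free rate), $S^i_1\in L$, that are arbitrage-free (there is no $\bar\theta\in\mathbb R^{1+d}$ with $\bar\theta\cdot\bar S_0\le0$,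 $\bar\theta\cdot\bar S_1\ge0$ a.s. and $\mathbb P[\bar\theta\cdot\bar S_1>0]>0$) and non-redundant ($S^0_1,\dots,S^d_1$ are linearly independent in $L$). Problem. For $\bar S\in\mathbb S(L)$, $w\in(0,\infty)$ and $R_{\max}\in[\mathcal R(w(1+r)),\infty)$, $(\mathcal U,\mathcal R)$-terminal-wealth portfolio selection is: maximize $\mathcal U(\bar\theta\cdot\bar S_1)$ over $\bar\theta\in\mathbb R^{1+d}$ with $\bar\theta\cdot\bar S_0=w$ and $\mathcal R(\bar\theta\cdot\bar S_1)\le R_{\max}$. It is well posed for $\bar S$ if for every such $w$ and $R_{\max}$ a maximizer exists; weakly well posed for $\bar S$ if for every such $w$ and $R_{\max}$ the supremum is strictly less than $\mathcal U(\infty)$; market-independent (weakly) well posed if it is (weakly) well posed for every $\bar S\in\mathbb S(L)$. *)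

(* Defs.v *)
From HB Require Import structures.
From mathcomp Require Export all_boot all_order all_algebra.
From mathcomp Require Export all_classical all_reals all_analysis.
From mathcomp Require Export measurable_realfun.

Set Implicit Arguments.
Unset Strict Implicit.
Unset Printing Implicit Defensive.

Import Order.TTheory GRing.Theory Num.Theory.
Import numFieldNormedType.Exports.

Local Open Scope classical_set_scope.
Local Open Scope ring_scope.

Section Setting.
Context (d : measure_display) (T : measurableType d) (R : realType)
  (P : probability T R).

Definition atomless : Prop :=
  forall A : set T, measurable A -> (0 < P A)%E ->
  exists B : set T, [/\ measurable B, B `<=` A, (0 < P B)%E & (P B < P A)%E].

(* Random variables are functions here, not classes modulo a.s. equality;
   the a.s. preorder takes the place of the order on classes. *)
Definition le_as (Y Z : {RV P >-> R}) : Prop := {ae P, forall x, Y x <= Z x}.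

(* The library extends measures to non-measurable sets by unspecified values,
   so laws may only be compared on measurable sets. *)
Definition same_law (Y Z : {RV P >-> R}) : Prop :=
  forall B : set R, measurable B -> distribution P Y B = distribution P Z B.

Definition cstRV (c : R) : {RV P >-> R} := cst c.

(* A functional on L is a function on all random variables of which only
   the values on L matter. *)
Implicit Types (L : set {RV P >-> R}) (U rho H : {RV P >-> R} -> \bar R).

Definition is_sup_as L (Y Z W : {RV P >-> R}) : Prop :=
  [/\ L W, le_as Y W, le_as Z W &
      forall V, L V -> le_as Y V -> le_as Z V -> le_as W V].

Definition is_inf_as L (Y Z W : {RV P >-> R}) : Prop :=
  [/\ L W, le_as W Y, le_as W Z &
      forall V, L V -> le_as V Y -> le_as V Z -> le_as V W].

Record riesz_space L : Prop := RieszSpace {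
  riesz0 : L 0;
  riesz_lin : forall (a : R) Y Z, L Y -> L Z -> L (a *: Y + Z);
  riesz_sup : forall Y Z, L Y -> L Z -> exists W, is_sup_as L Y Z W;
  riesz_inf : forall Y Z, L Y -> L Z -> exists W, is_inf_as L Y Z W }.

(* Random variables that are a.s. equal have the same law, so the last field
   also makes L closed under a.s. equality. *)
Record admissible_space L : Prop := AdmissibleSpace {
  space_riesz : riesz_space L;
  space_Linfty : forall Y : {RV P >-> R}, (Y : T -> R) \in Lfun P +oo%E -> L Y;
  space_L1 : forall Y : {RV P >-> R}, L Y -> (Y : T -> R) \in Lfun P 1%E;
  space_law : forall Y Z : {RV P >-> R}, L Y -> same_law Y Z -> L Z }.

Definition at_infty U : \bar R := lim (U (cstRV y) @[y --> +oo]).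

Record utility_functional L U : Prop := UtilityFunctional {
  utility_ltoo : forall Y, L Y -> (U Y < +oo)%E;
  utility_incr : forall Y Z, L Y -> L Z -> le_as Y Z -> (U Y <= U Z)%E;
  utility_cst : forall c : R, 0 < c -> U (cstRV c) \is a fin_num;
  utility_lt_infty : forall Y, L Y -> (U Y < at_infty U)%E }.

Record risk_functional L rho : Prop := RiskFunctional {
  risk_gtNoo : forall Y, L Y -> (-oo < rho Y)%E;
  risk_decr : forall Y Z, L Y -> L Z -> le_as Y Z -> (rho Z <= rho Y)%E;
  risk_cst : forall c : R, 0 < c -> rho (cstRV c) \is a fin_num }.

Definition normalized H : Prop := H (cstRV 0) = 0%E.

Definition cash_convex L rho : Prop :=
  forall (l : R) Y (c : R), 0 < l -> l < 1 -> L Y ->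
  (rho (l *: Y + (1 - l) *: cstRV c)%R
     <= l%:E * rho Y + (1 - l)%:E * rho (cstRV c))%E.

Definition law_invariant L H : Prop :=
  forall Y Z, L Y -> L Z -> same_law Y Z -> H Y = H Z.

Definition dominated_cvg L (Y_ : nat -> {RV P >-> R}) (Y : {RV P >-> R}) :
    Prop :=
  [/\ forall n, L (Y_ n), L Y,
      {ae P, forall x, Y_ n x @[n --> \oo] --> Y x} &
      exists2 Z, L Z & forall n, {ae P, forall x, `|Y_ n x| <= Z x}].

Definition upper_fatou L H : Prop :=
  forall Y_ Y, dominated_cvg L Y_ Y -> (limn_esup (fun n => H (Y_ n)) <= H Y)%E.

Definition lower_fatou L H : Prop :=
  forall Y_ Y, dominated_cvg L Y_ Y -> (H Y <= limn_einf (fun n => H (Y_ n)))%E.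

Definition has_loss L (Y : {RV P >-> R}) : Prop :=
  L Y /\ (0 < P [set x | (Y x < 0)%R])%E.

Definition SLL_risk L rho : Prop :=
  forall Y, has_loss L Y ->
  exists2 lY : R, 0 < lY & forall l : R, lY < l -> (0 < rho (l *: Y))%E.

Definition SLL_utility L U : Prop :=
  forall Y, has_loss L Y ->
  exists2 lY : R, 0 < lY & forall l : R, lY < l -> (U (l *: Y) < 0)%E.

Definition ASLL L U : Prop :=
  forall Y, has_loss L Y ->
  (limf_esup (fun l : R => U (l *: Y)) +oo%R < at_infty U)%E.

Definition sensitivity_equivalent L U : Prop := ASLL L U <-> SLL_utility L U.

(* There are [risky S] risky assets besides the riskless one. The value 0 is
   allowed; such a market has a single feasible portfolio for each wealth. *)
Record market := Market {
  risky : nat;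
  rate : R;
  price0 : 'rV[R]_risky.+1;
  price1 : 'I_risky.+1 -> {RV P >-> R} }.

Definition portfolio (S : market) := 'rV[R]_(risky S).+1.

Definition wealth0 (S : market) (theta : portfolio S) : R :=
  \sum_i theta ord0 i * price0 S ord0 i.

Definition wealth1 (S : market) (theta : portfolio S) : {RV P >-> R} :=
  \sum_i theta ord0 i *: (price1 i : {mfun T >-> R}).

Definition arbitrage_free (S : market) : Prop :=
  ~ exists theta : portfolio S,
      [/\ wealth0 theta <= 0,
          {ae P, forall x, 0 <= wealth1 theta x} &
          (0 < P [set x | (0 < wealth1 theta x)%R])%E].

Definition nonredundant (S : market) : Prop :=
  forall theta : portfolio S,
  {ae P, forall x, wealth1 theta x = 0} -> theta = 0.

Record admissible_market L (S : market) : Prop := AdmissibleMarket {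
  market_price0 : forall i, price0 S ord0 i = 1;
  market_rate : -1 < rate S;
  market_riskfree :
    {ae P, forall x, (price1 (ord0 : 'I_(risky S).+1)) x = 1 + rate S};
  market_price1 : forall i : 'I_(risky S).+1, L (price1 i);
  market_arbitrage_free : arbitrage_free S;
  market_nonredundant : nonredundant S }.

Definition feasible rho (w Rmax : R) (S : market) (theta : portfolio S) :
    Prop :=
  wealth0 theta = w /\ (rho (wealth1 theta) <= Rmax%:E)%E.

Definition problem_data rho (S : market) (w Rmax : R) : Prop :=
  0 < w /\ (rho (cstRV (w * (1 + rate S))) <= Rmax%:E)%E.

Definition well_posed U rho (S : market) : Prop :=
  forall w Rmax : R, problem_data rho S w Rmax ->
  exists2 theta : portfolio S, feasible rho w Rmax theta &
    forall theta' : portfolio S, feasible rho w Rmax theta' ->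
      (U (wealth1 theta') <= U (wealth1 theta))%E.

Definition weakly_well_posed U rho (S : market) : Prop :=
  forall w Rmax : R, problem_data rho S w Rmax ->
  (ereal_sup [set U (wealth1 theta) |
                theta in [set theta : portfolio S | feasible rho w Rmax theta]]
     < at_infty U)%E.

Definition market_independent_well_posed L U rho : Prop :=
  forall S, admissible_market L S -> well_posed U rho S.

Definition market_independent_weakly_well_posed L U rho : Prop :=
  forall S, admissible_market L S -> weakly_well_posed U rho S.

End Setting.

(* Main.v *)
Require Import Defs.
From mathcomp Require Import ess_sup_inf lra.

(** Boundedness of the relevant portfolios is the heart of SLL => well-posedness:
    an unbounded sequence of feasible portfolios, divided by its norms, converges
    to a nonzero portfolio of zero cost, which has a loss by absence of arbitrage.
    Cash-convexity and the lower Fatou property then bound the risk of all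
    multiples of this limit by 0, and slightly enlarging the limit bounds the
    utility of the sequence by 0 if the utility satisfies SLL; so the sequence
    contradicts either form of SLL.  Boundedness, compactness and the Fatou
    properties yield a maximizer.

    Conversely, if both SLL conditions fail, sensitivity equivalence gives a
    payoff [Y] with a loss along which the utility comes arbitrarily close to its
    upper limit, and cash-convexity a payoff [Z] with a loss all of whose
    multiples have nonpositive risk.  By law-invariance and atomlessness one of
    the two can be rearranged so that both losses occur simultaneously with
    positive probability; then [max(Y, Z)] is the excess return of a stock whose
    market is not weakly well posed. *)

Set Implicit Arguments.
Unset Strict Implicit.
Unset Printing Implicit Defensive.

Import Order.TTheory GRing.Theory Num.Theory.
Import numFieldNormedType.Exports.

Local Open Scope classical_set_scope.
Local Open Scope ring_scope.

(** * Sets of prescribed probability in an atomless space *)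

Section AtomlessMeasure.
Context (d : measure_display) (T : measurableType d) (R : realType)
  (P : probability T R).
Implicit Types A B C D : set T.

Let p A : R := fine (P A).

Let pE A : measurable A -> P A = (p A)%:E.
Proof. by move=> mA; rewrite fineK// fin_num_measure. Qed.

Let p_ge0 A : 0 <= p A. Proof. exact: fine_ge0. Qed.

Let p_le A B : measurable A -> measurable B -> A `<=` B -> p A <= p B.
Proof.
by move=> mA mB AB; rewrite -lee_fin -!pE// le_measure ?inE.
Qed.

Let pD A B : measurable A -> measurable B -> A `<=` B ->
  p (B `\` A) = p B - p A.
Proof.
move=> mA mB AB; have mD : measurable (B `\` A) by exact: measurableD.
have e : P (B `\` A) = (P B - P (B `&` A))%E.
  by apply: measureD => //; have := ltry (p B); rewrite -pE.
by apply: EFin_inj; rewrite -pE// e setIidr// !pE.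
Qed.

(** Of a proper piece and its complement within the current set, one has at most half the measure.
    Keeping that one repeatedly drives the measure to 0; decay of order [1 / n] is enough to get
    below [e]. *)
Lemma atomless_small (hP : atomless P) A (e : R) :
  measurable A -> (0 < P A)%E -> 0 < e ->
  exists C, [/\ measurable C, C `<=` A, (0 < P C)%E & (P C <= e%:E)%E].
Proof.
move=> mA A0 e0.
have halves n : exists C, [/\ measurable C, C `<=` A, 0 < p C &
    p C * n.+1%:R <= p A].
  elim: n => [|n [C [mC CA C0 Cn]]].
    by exists A; split; rewrite ?mulr1// -lte_fin -pE.
  have PC0 : (0 < P C)%E by rewrite pE.
  have [B [mB BC B0 BltC]] := hP C mC PC0.
  have pB0 : 0 < p B by rewrite -lte_fin -pE.
  have pBC : p B < p C by rewrite -lte_fin -!pE.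
  (* Since [n + 2 <= 2 * (n + 1)], one halving pays for raising the factor from [n + 1] to
     [n + 2]. *)
  have nn : p C * (n.+2)%:R <= 2 * (p C * n.+1%:R).
    rewrite mulrCA ler_wpM2l// -natrM ler_nat.
    by rewrite mul2n -addnn addSn ltnS leq_addl.
  have half D : p D * 2 <= p C -> p D * n.+2%:R <= p A.
    move=> DC; apply: le_trans Cn; rewrite -(ler_pM2l (@ltr0n R 2)) in nn *.
    have := ler_wpM2r (ler0n R n.+2) DC; move: nn; lra.
  have [h|h] := lerP (p B * 2) (p C).
    by exists B; split=> //; [exact: subset_trans CA|exact: half].
  exists (C `\` B); split; first exact: measurableD.
  - by move=> x [/CA].
  - by rewrite pD// subr_gt0.
  - by apply: half; rewrite pD//; lra.
pose n := Num.bound (p A / e).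
have [C [mC CA C0 Cn]] := halves n.
exists C; split; rewrite ?pE// lee_fin.
have : p A / e < n.+1%:R.
  apply: (lt_trans (archi_boundP _)); first by rewrite divr_ge0// ltW.
  by rewrite ltr_nat.
rewrite ltr_pdivrMr// => h.
rewrite -(@ler_pM2r _ n.+1%:R)//; apply: (le_trans Cn).
by rewrite mulrC ltW.
Qed.

(* Greedy exhaustion: each step adds at least half of what could be added
   without exceeding [t], so a set of positive measure that could still be
   added at the end could have been added infinitely often. *)
Lemma atomless_intermediate (hP : atomless P) A (t : R) :
  measurable A -> 0 <= t -> (t%:E <= P A)%E ->
  exists B, [/\ measurable B, B `<=` A & P B = t%:E].
Proof.
move=> mA t0 tA.
pose good D := [/\ measurable D, D `<=` A & p D <= t].
(* The premise [good D] stands under the existential so that [choice] yields a total function, which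
   can then be iterated from the empty set. *)
have step D : exists D', good D -> [/\ good D', D `<=` D' &
    forall C, measurable C -> C `<=` A `\` D -> p D + p C <= t ->
      p C <= 2 * (p D' - p D)].
  have [[mD DA Dt]|nD] := pselect (good D); last by exists D.
  pose E := [set p C | C in
    [set C | [/\ measurable C, C `<=` A `\` D & p D + p C <= t]]].
  have E0 : E 0.
    by exists set0; [split=> //; rewrite /p measure0 addr0|rewrite /p measure0].
  have ubE : has_sup E.
    split; first by exists 0.
    by exists t => _ [C [_ _ h] <-]; have := p_ge0 D; lra.
  have [C [mC CD Ct] hC] : exists2 C,
      [/\ measurable C, C `<=` A `\` D & p D + p C <= t] &
      forall C', measurable C' -> C' `<=` A `\` D -> p D + p C' <= t ->
        p C' <= 2 * p C.
    (* The supremum need not be attained. If it is positive, some element lies within [sup E / 2] of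
       it and so exceeds half of every competitor; otherwise the empty set will do. *)
    have [s0|s0] := lerP (sup E) 0.
      exists set0; first by split=> //; rewrite /p measure0 addr0.
      move=> C' mC' C'D C't; rewrite /p measure0 mulr0.
      by apply: le_trans s0; apply: ub_le_sup; [exact: ubE.2|exists C'].
    have s20 : 0 < sup E / 2 by rewrite divr_gt0.
    have [_ [C hC <-] h] := sup_adherent s20 ubE.
    exists C => // C' mC' C'D C't.
    have : p C' <= sup E by apply: ub_le_sup; [exact: ubE.2|exists C'].
    move: h; lra.
  have DDC : D `<=` D `|` C by move=> x; left.
  have pDC : p (D `|` C) = p D + p C.
    apply: EFin_inj; rewrite EFinD -!pE//; last exact: measurableU.
    rewrite measureU//; apply/seteqP; split=> // x [Dx /CD[]//].
  exists (D `|` C) => _; split => //.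
  - split; first exact: measurableU.
    + by move=> x [/DA//|/CD[]].
    + by rewrite pDC.
  - move=> C' mC' C'D C't; rewrite pDC addrAC subrr add0r; exact: hC.
have [f fP] := choice step.
pose D n := iter n f set0.
have gD n : good (D n).
  elim: n => [|n /fP[]//]; split => //=; by rewrite /p measure0.
have DS n : D n `<=` D n.+1 by have [] := fP _ (gD n).
have mD n : measurable (D n) by have [] := gD n.
pose B := \bigcup_n D n.
have mB : measurable B by exact: bigcupT_measurable.
have BA : B `<=` A by move=> x [n _]; have [_ + _] := gD n; apply.
have ndD : nondecreasing_seq D.
  by apply/nondecreasing_seqP => n; apply/subsetPset; exact: DS.
have pB : p B <= t.
  rewrite -lee_fin -pE//.
  have cv : P (D n) @[n --> \oo] --> P B by exact: nondecreasing_cvg_mu.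
  rewrite -(cvg_lim _ cv)//; apply: lime_le.
    by apply/cvg_ex; eexists; exact: cv.
  by apply: nearW => n /=; rewrite pE// lee_fin; have [] := gD n.
exists B; split=> //; rewrite pE//; congr EFin; apply/eqP.
rewrite eq_le pB leNgt; apply/negP => Bt.
have rest : (0 < P (A `\` B))%E.
  rewrite pE ?lte_fin; last exact: measurableD.
  by rewrite pD// subr_gt0; apply: lt_le_trans Bt _; rewrite -lee_fin -pE.
have tB : 0 < t - p B by rewrite subr_gt0.
have [C [mC CAB C0 Ct]] := atomless_small hP (measurableD mA mB) rest tB.
have pC0 : 0 < p C by rewrite -lte_fin -pE.
have pCt : p C <= t - p B by rewrite -lee_fin -pE.
have inc n : p C <= 2 * (p (D n.+1) - p (D n)).
  have [_ _] := fP _ (gD n); apply => //.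
    by move=> x /CAB[Ax Bx]; split=> // Dx; apply: Bx; exists n.
  have : p (D n) <= p B by apply: p_le => // x Dx; exists n.
  move: pCt; lra.
have lin n : p C * n%:R <= 2 * p (D n).
  elim: n => [|n ih]; first by rewrite mulr0 mulr_ge0.
  by rewrite -natr1 mulrDr mulr1; move: (inc n) ih; lra.
have := archi_boundP (_ : 0 <= 2 * t / p C); set n := Num.bound _.
rewrite divr_ge0 ?mulr_ge0// => /(_ isT); rewrite ltr_pdivrMr// => h.
have [_ _ Dt] := gD n; move: (lin n); move: h Dt; rewrite mulrC; lra.
Qed.

End AtomlessMeasure.

(** * Closure properties of the space [L] *)

Section RandomVariables.
Context (d : measure_display) (T : measurableType d) (R : realType)
  (P : probability T R).
Implicit Types (A B : set T) (X Y Z : {RV P >-> R}).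

Lemma measurable_RV_lt Y (c : R) : measurable [set x | Y x < c].
Proof.
rewrite (_ : [set _ | _] = Y @^-1` `]-oo, c[); first exact: measurable_funPTI.
by apply/seteqP; split=> x /=; rewrite in_itv.
Qed.

Lemma measurable_RV_gt Y (c : R) : measurable [set x | c < Y x].
Proof.
rewrite (_ : [set _ | _] = Y @^-1` `]c, +oo[); first exact: measurable_funPTI.
by apply/seteqP; split=> x /=; rewrite in_itv/= andbT.
Qed.

Lemma measurable_RV_le Y (c : R) : measurable [set x | Y x <= c].
Proof.
rewrite (_ : [set _ | _] = Y @^-1` `]-oo, c]); first exact: measurable_funPTI.
by apply/seteqP; split=> x /=; rewrite in_itv.
Qed.

Lemma ae_le0 A : measurable A -> ~ (0 < P A)%E -> {ae P, forall x, ~ A x}.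
Proof.
move=> mA /negP; rewrite lt_neqAle measure_ge0 andbT negbK => /eqP A0.
apply/negligibleP; first by rewrite setCK.
by rewrite setCK.
Qed.

Lemma le_measure_ae A B : measurable A -> measurable B ->
  {ae P, forall x, A x -> B x} -> (P A <= P B)%E.
Proof.
move=> mA mB [N [mN N0 AB]].
rewrite -(measureU0 mB mN N0) le_measure ?inE//; first exact: measurableU.
move=> x Ax; have [Bx|nBx] := pselect (B x); [by left|right].
by apply: AB => /= /(_ Ax).
Qed.

(** A countable union of null events is null. This later turns strict pointwise inequalities into
    ones with a uniform margin on a non-null event. *)
Lemma bigcup_gt0 A (B : (set T)^nat) : measurable A ->
  (forall n, measurable (B n)) -> (0 < P A)%E -> A `<=` \bigcup_n B n ->
  exists n, (0 < P (B n))%E.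
Proof.
move=> mA mB A0 AB; apply: contrapT => /forallNP nB.
have : (0 < P (\bigcup_n B n))%E.
  by apply: lt_le_trans A0 _; rewrite le_measure ?inE//; exact: bigcupT_measurable.
suff /negligibleP : P.-negligible (\bigcup_n B n).
  by move=> ->; rewrite ?ltxx//; exact: bigcupT_measurable.
apply: negligible_bigcup => n; apply/negligibleP => //.
by have /negP := nB n; rewrite lt_neqAle measure_ge0 andbT negbK => /eqP.
Qed.

Context (L : set {RV P >-> R}) (hL : admissible_space L).

Lemma space_ae Y Z : L Y -> {ae P, forall x, Y x = Z x} -> L Z.
Proof.
move=> LY YZ; apply: (space_law hL LY) => B mB.
rewrite /distribution /pushforward/=; have mY : measurable (Y @^-1` B) by exact: measurable_funPTI.
have mZ : measurable (Z @^-1` B) by exact: measurable_funPTI.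
apply/eqP; rewrite eq_le; apply/andP; split; apply: le_measure_ae => //.
  by apply: filterS YZ => x /= ->.
by apply: filterS YZ => x /= ->.
Qed.

Lemma space_bounded Y (M : R) : (forall x, `|Y x| <= M) -> L Y.
Proof.
move=> YM; apply: (space_Linfty hL); rewrite inE; apply/andP; split.
  by rewrite inE/=.
rewrite inE/= /finite_norm unlock /=.
case: ifPn => _; last by [].
apply: le_lt_trans (ltry M); apply/ess_supP; apply: nearW => x /=.
by rewrite lee_fin.
Qed.

Lemma space_cst (c : R) : L (cstRV P c).
Proof. exact: (@space_bounded _ `|c|). Qed.

Lemma space_lin (a : R) Y Z : L Y -> L Z -> L (a *: Y + Z).
Proof. exact: riesz_lin (space_riesz hL) a Y Z. Qed.

Lemma space_add Y Z : L Y -> L Z -> L (Y + Z).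
Proof. by move=> LY LZ; rewrite -[Y]scale1r; exact: space_lin. Qed.

Lemma space_scale (a : R) Y : L Y -> L (a *: Y).
Proof.
by move=> LY; rewrite -[_ *: _]addr0; apply: space_lin => //; exact: riesz0 (space_riesz hL).
Qed.

Lemma space_sum (I : Type) (s : seq I) (F : I -> {mfun T >-> R}) :
  (forall i, L (F i)) -> L (\sum_(i <- s) F i).
Proof.
move=> LF; elim/big_ind: _ => //; [exact: riesz0 (space_riesz hL) | exact: space_add].
Qed.

(** The lattice gives a supremum [W] that is least only among upper bounds in [L], and the pointwise
    maximum is not yet known to be one of them. Lowering [W] by [1 / (n + 1)] where it exceeds the
    maximum by more than that is a bounded change, so the result is in [L] and still an upper bound.
    Minimality of [W] makes each of these events null. *)
Lemma space_max Y Z : L Y -> L Z -> L (max_mfun Y Z).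
Proof.
move=> LY LZ; have [W [LW YW ZW Wmin]] := riesz_sup (space_riesz hL) LY LZ.
apply: (space_ae LW).
pose D : {RV P >-> R} := W - max_mfun Y Z.
have small (n : nat) : {ae P, forall x, ~ n.+1%:R^-1 < D x}.
  have mA := measurable_RV_gt D n.+1%:R^-1.
  pose V : {RV P >-> R} := (- n.+1%:R^-1) *: (indic_mfun _ mA : {mfun T >-> R}) + W.
  have VE x : V x = W x - n.+1%:R^-1 * (n.+1%:R^-1 < D x)%R%:R.
    rewrite -[V x]/(- n.+1%:R^-1 * indic_mfun _ mA x + W x) mulNr addrC; congr (_ - _ * _).
    rewrite /indic_mfun/= mindicE; congr (_%:R).
    by congr nat_of_bool; apply/idP/idP; rewrite inE.
  have LV : L V.
    apply: space_lin => //; apply: (@space_bounded _ 1) => x.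
    by rewrite /indic_mfun/= mindicE; case: (_ \in _); rewrite ?normr1 ?normr0.
  have DE x : D x = W x - Num.max (Y x) (Z x) by [].
  have inv0 : 0 < n.+1%:R^-1 :> R by rewrite invr_gt0.
  have VW X x : X x <= Num.max (Y x) (Z x) -> X x <= W x -> X x <= V x.
    rewrite VE DE; move: inv0; set e := n.+1%:R^-1; set m := Num.max _ _ => e0.
    by case: ltP => /=; rewrite ?mulr1n ?mulr0n ?mulr1 ?mulr0; lra.
  have YV : le_as Y V.
    by apply: filterS YW => x; apply: VW; rewrite le_max lexx.
  have ZV : le_as Z V.
    by apply: filterS ZW => x; apply: VW; rewrite le_max lexx orbT.
  apply: filterS (Wmin V LV YV ZV) => x; rewrite VE.
  move=> h lt_eD; move: h; rewrite lt_eD/= mulr1n mulr1.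
  by move: inv0; set e := _^-1; lra.
have {}small := ae_foralln small.
apply: filterS3 small YW ZW => x Dx Yx Zx; apply/eqP; rewrite eq_le.
apply/andP; split; last by rewrite /= ge_max Yx Zx.
rewrite leNgt; apply/negP => DD.
have : 0 < W x - max_mfun Y Z x by rewrite subr_gt0.
move=> D0; apply: (Dx (Num.bound (W x - max_mfun Y Z x)^-1)).
rewrite invf_plt ?posrE//.
apply: (lt_trans (archi_boundP _)); first by rewrite invr_ge0 ltW.
by rewrite ltr_nat.
Qed.

(** Written as a join, so that membership in [L] follows from [space_max]. *)
Definition abs_RV Y : {RV P >-> R} := max_mfun Y (- Y).

Lemma abs_RVE Y x : abs_RV Y x = `|Y x|.
Proof. by rewrite -maxNr maxC. Qed.

Lemma space_abs Y : L Y -> L (abs_RV Y).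
Proof.
by move=> LY; apply: space_max => //; rewrite -scaleN1r; exact: space_scale.
Qed.

End RandomVariables.

(** * Rearranging a payoff without changing its law *)

Section Swap.
Context (d : measure_display) (T : measurableType d) (R : realType)
  (P : probability T R).
Implicit Types (A B S : set T) (X Y Z G : {RV P >-> R}).

Lemma same_law_scale (a : R) Y Z : same_law Y Z ->
  @same_law _ _ _ P (a *: Y) (a *: Z).
Proof.
move=> YZ B mB; apply: (YZ ((fun r => a * r) @^-1` B)).
have ma : measurable_fun setT (fun r : R => a * r) by exact: measurable_funM.
by rewrite -[_ @^-1` _]setTI; exact: ma.
Qed.

Lemma measure_split2 A B S : measurable A -> measurable B -> measurable S ->
  [disjoint A & B] ->
  P S = (P (S `\` (A `|` B)) + (P (S `&` A) + P (S `&` B)))%E.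
Proof.
move=> mA mB mS /disj_setPS AB0.
have mAB := measurableU _ _ mA mB.
rewrite -[in LHS](setUIDK S (A `|` B)) measureU; last first.
  by apply/seteqP; split=> // x [[]] ? ? [].
- exact: measurableD.
- exact: measurableI.
rewrite addeC; congr (_ + _)%E.
rewrite setIUr measureU//; try exact: measurableI.
by apply/seteqP; split=> // x [[_ Ax] [_ Bx]]; apply: (AB0 x).
Qed.

(** For a Borel set [S], the preimages agree outside [A] and [B]. Inside, each of [A] and [B] counts
    fully or not at all, according to whether its constant lies in [S]; as [P A = P B], exchanging
    the constants leaves the sum unchanged. *)
Lemma same_law_swap A B (a b : R) Y Z : measurable A -> measurable B ->
  [disjoint A & B] -> P A = P B ->
  (forall x, A x -> Y x = a) -> (forall x, B x -> Y x = b) ->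
  (forall x, A x -> Z x = b) -> (forall x, B x -> Z x = a) ->
  (forall x, ~ A x -> ~ B x -> Y x = Z x) -> same_law Y Z.
Proof.
move=> mA mB AB0 PAB YA YB ZA ZB YZ S mS; rewrite /distribution /pushforward/=.
have part X C c : (forall x, C x -> X x = c) ->
    P (X @^-1` S `&` C) = if c \in S then P C else 0%E.
  move=> XC; case: ifPn => [/set_mem Sc|/negP nSc].
    by congr (P _); apply/seteqP; split=> [x []//|x Cx]; split=> //=; rewrite XC.
  rewrite (_ : _ `&` _ = set0) ?measure0//; apply/seteqP; split=> // x [/= SX Cx].
  by apply: nSc; rewrite inE -(XC x).
have mpre X : measurable (X @^-1` S) by exact: measurable_funPTI.
rewrite (measure_split2 mA mB (mpre Y) AB0) (measure_split2 mA mB (mpre Z) AB0).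
rewrite (part _ _ _ YA) (part _ _ _ YB) (part _ _ _ ZA) (part _ _ _ ZB) PAB.
rewrite [in RHS]addeC [in LHS]addeC; congr (_ + _)%E; first by rewrite addeC.
congr (P _); apply/seteqP; split=> x /= [SX nAB]; split=> //.
  by rewrite -YZ// => h; apply: nAB; [left|right].
by rewrite YZ// => h; apply: nAB; [left|right].
Qed.

Context (L : set {RV P >-> R}) (hL : admissible_space L).

(** The difference between [G] and [X] is bounded, because [X] is bounded where it is changed; hence
    [G] stays in [L]. *)
Lemma space_modify A B (a b M : R) X : measurable A -> measurable B ->
  [disjoint A & B] -> L X -> (forall x, A x \/ B x -> `|X x| <= M) ->
  exists G, [/\ L G, forall x, A x -> G x = a, forall x, B x -> G x = b &
    forall x, ~ A x -> ~ B x -> G x = X x].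
Proof.
move=> mA mB /disj_setPS AB0 LX XM.
pose IA : {mfun T >-> R} := indic_mfun A mA.
pose IB : {mfun T >-> R} := indic_mfun B mB.
pose D : {RV P >-> R} := (cst a - X) * IA + (cst b - X) * IB.
have DE x : D x = (a - X x) * (x \in A)%:R + (b - X x) * (x \in B)%:R.
  by rewrite -[LHS]/((a - X x) * IA x + (b - X x) * IB x) /IA /IB /indic_mfun/= !mindicE.
have inA x : A x -> ((x \in A) = true) * ((x \in B) = false).
  move=> Ax; split; first by apply/mem_set.
  by apply/negP; rewrite inE => Bx; apply: (AB0 x).
have inB x : B x -> ((x \in A) = false) * ((x \in B) = true).
  move=> Bx; split; last by apply/mem_set.
  by apply/negP; rewrite inE => Ax; apply: (AB0 x).
have notin (C : set T) x : ~ C x -> (x \in C) = false.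
  by move=> nC; apply/negP; rewrite inE.
have GE x : (D + X) x = D x + X x by [].
exists (D + X); split.
(* The absolute value of [M] keeps the bound valid outside [A] and [B], where [D] vanishes but [M]
   could be negative. *)
- apply: space_add => //; apply: (@space_bounded _ _ _ _ _ hL _ (`|a| + `|b| + `|M|)) => x.
  rewrite DE; have [Ax|nA] := pselect (A x).
    rewrite !(inA x Ax) mulr1 mulr0 addr0; apply: (le_trans (ler_normB _ _)).
    have := XM x (or_introl Ax); have := ler_norm M; have := normr_ge0 b; lra.
  have [Bx|nB] := pselect (B x).
    rewrite !(inB x Bx) mulr1 mulr0 add0r; apply: (le_trans (ler_normB _ _)).
    have := XM x (or_intror Bx); have := ler_norm M; have := normr_ge0 a; lra.
  by rewrite !notin// !mulr0 addr0 normr0 !addr_ge0.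
- by move=> x Ax; rewrite GE DE !(inA x Ax) mulr1 mulr0 addr0 subrK.
- by move=> x Bx; rewrite GE DE !(inB x Bx) mulr1 mulr0 add0r subrK.
- by move=> x nA nB; rewrite GE DE !notin// !mulr0 addr0 add0r.
Qed.

(* If the two loss events are essentially disjoint, [Y] is first increased to
   two constants on two small sets of equal probability, one inside each loss
   event; exchanging these two constants keeps the law. *)
Lemma overlapping_losses (hP : atomless P) Y Z : has_loss L Y -> has_loss L Z ->
  exists Y1 Y2, [/\ L Y1, L Y2, le_as Y Y1, same_law Y1 Y2 &
    (0 < P ([set x | (Y2 x < 0)%R] `&` [set x | (Z x < 0)%R]))%E].
Proof.
move=> [LY Y0] [LZ Z0]; set A := [set x | Y x < 0]; set B := [set x | Z x < 0].
have mA : measurable A by exact: measurable_RV_lt.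
have mB : measurable B by exact: measurable_RV_lt.
have mAB : measurable (A `&` B) by exact: measurableI.
have [AB0|/(ae_le0 mAB) nAB] := pselect (0 < P (A `&` B))%E.
  by exists Y, Y; split=> //; exact: aeW.
have mAmB := measurableD mA mB.
have mBmA := measurableD mB mA.
(* A constant that is still negative and yet dominates [Y] is available on a non-null part of the
   loss event of [Y]; similarly a finite upper bound [m] on part of the loss event of [Z]. *)
have [n An] : exists n : nat,
    (0 < P ([set x | (Y x <= - n.+1%:R^-1)%R] `&` (A `\` B)))%E.
  apply: (@bigcup_gt0 _ _ _ P (A `\` B)) => //.
  - by move=> n; apply: measurableI => //; exact: measurable_RV_le.
  - apply: lt_le_trans Y0 _; apply: le_measure_ae => //.
    by apply: filterS nAB => x h Ax; split=> // Bx; apply: h.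
  - move=> x ABx; have [Yx _] := ABx.
    exists (Num.bound (- Y x)^-1) => //; split=> //=.
    rewrite lerNr invf_ple ?posrE ?oppr_gt0//.
    apply/ltW/(lt_trans (archi_boundP _)); last by rewrite ltr_nat.
    by rewrite invr_ge0 oppr_ge0 ltW.
have [m Bm] : exists m : nat,
    (0 < P ([set x | (Y x <= m%:R)%R] `&` (B `\` A)))%E.
  apply: (@bigcup_gt0 _ _ _ P (B `\` A)) => //.
  - by move=> m; apply: measurableI => //; exact: measurable_RV_le.
  - apply: lt_le_trans Z0 _; apply: le_measure_ae => //.
    by apply: filterS nAB => x h Bx; split=> // Ax; apply: h.
  - move=> x BAx; exists (Num.bound `|Y x|) => //; split=> //=.
    by apply: (le_trans (ler_norm _)); apply/ltW/archi_boundP.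
set A0 := _ `&` (A `\` B) in An; set B0 := _ `&` (B `\` A) in Bm.
have mA0 : measurable A0 by apply: measurableI => //; exact: measurable_RV_le.
have mB0 : measurable B0 by apply: measurableI => //; exact: measurable_RV_le.
have finP S : measurable S -> P S = (fine (P S))%:E.
  by move=> mS; rewrite fineK// fin_num_measure.
pose t := Num.min (fine (P A0)) (fine (P B0)).
have t0 : 0 < t.
  by rewrite lt_min -!lte_fin -!finP// An.
have [A1 [mA1 A1A0 PA1]] : exists C, [/\ measurable C, C `<=` A0 & P C = t%:E].
  apply: atomless_intermediate => //; first exact: ltW.
  by rewrite finP// lee_fin ge_min lexx.
have [B1 [mB1 B1B0 PB1]] : exists C, [/\ measurable C, C `<=` B0 & P C = t%:E].
  apply: atomless_intermediate => //; first exact: ltW.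
  by rewrite finP// lee_fin ge_min lexx orbT.
have AB1 : [disjoint A1 & B1].
  apply/disj_setPS => x [/A1A0[_ [_ nB]] /B1B0[_ [Bx _]]]; exact: nB.
(* [Y] may be unbounded below on the two small sets, whereas its positive part is at most [m] there,
   as [space_modify] requires. Elsewhere the positive part still dominates [Y]. *)
pose e : R := n.+1%:R^-1; pose Yp : {RV P >-> R} := max_mfun Y (cst 0).
have LYp : L Yp by apply: space_max => //; exact: space_cst.
have YpE x : Yp x = Num.max (Y x) 0 by [].
have YpM x : A1 x \/ B1 x -> `|Yp x| <= m%:R.
  rewrite YpE ger0_norm ?le_max ?lexx ?orbT// ge_max ler0n andbT.
  move=> [/A1A0[_ [Yx _]]|/B1B0[]//]; apply: (le_trans (ltW Yx)); exact: ler0n.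
have [Y1 [LY1 Y1A Y1B Y1C]] :=
  space_modify (- e) m%:R mA1 mB1 AB1 LYp YpM.
have [Y2 [LY2 Y2A Y2B Y2C]] :=
  space_modify m%:R (- e) mA1 mB1 AB1 LYp YpM.
exists Y1, Y2; split=> //.
- apply: aeW => x; have [Ax|nAx] := pselect (A1 x).
    by rewrite Y1A//; have [] := A1A0 _ Ax.
  have [Bx|nBx] := pselect (B1 x); first by rewrite Y1B//; have [] := B1B0 _ Bx.
  by rewrite Y1C// YpE le_max lexx.
- apply: (@same_law_swap A1 B1 (- e) m%:R) => //; first by rewrite PA1 PB1.
  by move=> x nA nB; rewrite Y1C// Y2C.
- have : (0 < P B1)%E by rewrite PB1 lte_fin.
  move/lt_le_trans; apply; rewrite le_measure ?inE//.
    by apply: measurableI => //; exact: measurable_RV_lt.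
  move=> x Bx; split; last by have [_ []] := B1B0 _ Bx.
  by rewrite /= Y2B// oppr_lt0 invr_gt0.
Qed.

End Swap.

(** * From weak well-posedness to sensitivity to large losses *)

Lemma limf_esup_pinfty_le (R : realType) (f : R -> \bar R) :
  (limf_esup f +oo%R <= ereal_sup [set f l | l in [set l | (0 < l)%R]])%E.
Proof.
apply: ereal_inf_lbound; exists [set l | 0 < l] => //.
by exists 0; split.
Qed.

Section PortfolioSelection.
Context (d : measure_display) (T : measurableType d) (R : realType)
  (P : probability T R) (L : set {RV P >-> R}).
Implicit Types (X Y Z : {RV P >-> R}) (U rho : {RV P >-> R} -> \bar R).

Lemma wealth1E (S : market P) (theta : portfolio S) x :
  wealth1 theta x = \sum_i theta ord0 i * price1 i x.
Proof. by rewrite /wealth1 mfun_sum. Qed.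

Lemma ae_ex (A : set T) (Q : T -> Prop) : measurable A -> (0 < P A)%E ->
  {ae P, forall x, Q x} -> exists x, A x /\ Q x.
Proof.
move=> mA A0 Qae; apply: contrapT => /forallNP h.
have : (P A <= P set0)%E.
  by apply: le_measure_ae => //; apply: filterS Qae => x Qx Ax; apply: (h x).
by rewrite measure0 leNgt A0.
Qed.

Context (hL : admissible_space L).

(** This is cash-convexity against the constant 0, at which [rho] vanishes: [rho] is star-shaped. *)
Lemma risk_scale_le rho (l : R) Y : normalized rho -> cash_convex L rho ->
  0 < l -> l < 1 -> L Y -> (rho (l *: Y) <= l%:E * rho Y)%E.
Proof.
move=> rho0 cc l0 l1 LY; have := cc l Y 0 l0 l1 LY; rewrite rho0 mule0 adde0.
rewrite (_ : _ + _ = l *: Y)//; apply/mfuneqP => x.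
by rewrite -[LHS]/(l * Y x + (1 - l) * 0) mulr0 addr0.
Qed.

(** Failure of SLL only gives arbitrarily large multiples of nonpositive risk; star-shapedness
    carries the bound down to every smaller multiple. *)
Lemma not_SLL_risk rho : risk_functional L rho ->
  normalized rho -> cash_convex L rho -> ~ SLL_risk L rho ->
  exists2 Z, has_loss L Z & forall l : R, 0 < l -> (rho (l *: Z) <= 0)%E.
Proof.
move=> hR rho0 cc /existsNP[Z /not_implyP[lossZ nZ]]; exists Z => // l l0.
have LZ := lossZ.1.
have [k lk rk] : exists2 k : R, l < k & (rho (k *: Z) <= 0)%E.
  apply: contrapT => h; apply: nZ; exists l => // k lk; rewrite ltNge.
  by apply/negP => rk; apply: h; exists k.
have k0 : 0 < k by exact: lt_trans lk.
have -> : l *: Z = (l / k) *: (k *: Z).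
  by rewrite scalerA divfK// gt_eqF.
apply: (le_trans (risk_scale_le rho0 cc _ _ _)).
- by rewrite divr_gt0.
- by rewrite ltr_pdivrMr// mul1r.
- exact: space_scale.
- by apply: mule_ge0_le0 => //; rewrite lee_fin divr_ge0// ltW.
Qed.

(** With interest rate 0, terminal wealth is initial wealth plus the stock position times [X], so
    every multiple of [X] can be traded. *)
Definition one_stock_market X : market P :=
  @Market _ _ _ P 1 0 (const_mx 1)
    (fun i => if i == ord0 then cstRV P 1 else cstRV P 1 + X).

Lemma one_stock_wealth0 X (theta : portfolio (one_stock_market X)) :
  wealth0 theta = theta ord0 ord0 + theta ord0 (lift ord0 ord0).
Proof. by rewrite /wealth0 big_ord_recl big_ord1 !mxE !mulr1. Qed.

Lemma one_stock_wealth1 X (theta : portfolio (one_stock_market X)) x :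
  wealth1 theta x = wealth0 theta + theta ord0 (lift ord0 ord0) * X x.
Proof.
rewrite wealth1E one_stock_wealth0 big_ord_recl big_ord1 /=.
by rewrite -[in LHS]/(1 + X x) mulr1 mulrDr mulr1 addrA.
Qed.

(** Evaluating the a.s. statements at one point where [X] loses and one where it gains rules out
    arbitrage as well as redundancy: a nonzero stock position has opposite effects at the two
    points. *)
Lemma one_stock_admissible X : L X -> (0 < P [set x | (X x < 0)%R])%E ->
  (0 < P [set x | (0 < X x)%R])%E -> admissible_market L (one_stock_market X).
Proof.
move=> LX Xneg Xpos.
have mneg : measurable [set x | X x < 0] by exact: measurable_RV_lt.
have mpos : measurable [set x | 0 < X x] by exact: measurable_RV_gt.
split=> /=.
- by move=> i; rewrite mxE.
- by rewrite ltrN10.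
- by apply: aeW => x; rewrite addr0.
- by move=> i; case: ifP => _; [|apply: space_add => //]; exact: space_cst.
- move=> [theta [w0 ge0 gt0]]; set q := theta ord0 (lift ord0 ord0).
  have [x1 [/= x1neg]] := ae_ex mneg Xneg ge0.
  have [x2 [/= x2pos]] := ae_ex mpos Xpos ge0.
  rewrite !one_stock_wealth1 -/q => h2 h1.
  have mW : measurable [set x | 0 < wealth1 theta x].
    exact: measurable_RV_gt.
  have [x3 [/= ]] := ae_ex mW gt0 ge0.
  rewrite one_stock_wealth1 -/q => x3pos _; move: h1 h2 x3pos.
  have [q0|q0|->] := ltgtP q 0; nra.
- move=> theta eq0; set q := theta ord0 (lift ord0 ord0).
  have [x1 [/= x1neg]] := ae_ex mneg Xneg eq0.
  have [x2 [/= x2pos]] := ae_ex mpos Xpos eq0.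
  rewrite !one_stock_wealth1 -/q => h2 h1.
  have q0 : q = 0.
    have : q * (X x2 - X x1) = 0 by lra.
    by move/eqP; rewrite mulf_eq0 => /orP[/eqP//|/eqP]; lra.
  have w0 : wealth0 theta = 0 by move: h1; rewrite q0; lra.
  apply/rowP => i; rewrite mxE; move: w0; rewrite one_stock_wealth0 -/q q0 addr0.
  have [->//|/eqP ni] := pselect (i = ord0).
  move=> _; rewrite -q0 /q; congr (theta _ _).
  by have := ni; rewrite eq_sym => /unlift_some[j -> _]; rewrite ord1.
Qed.

(** Wealth 1 with amount [l] in the stock ends at [1 + l * X], which dominates [l *: X]. It is
    therefore feasible for the risk bound 0 and has at least the utility of [l *: X]. *)
Lemma weakly_well_posed_sup U rho X : utility_functional L U ->
  normalized U -> risk_functional L rho -> normalized rho ->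
  L X -> (0 < P [set x | (X x < 0)%R])%E ->
  (forall l : R, 0 < l -> (rho (l *: X) <= 0)%E) ->
  market_independent_weakly_well_posed L U rho ->
  (ereal_sup [set U (l *: X) | l in [set l : R | (0 < l)%R]] < at_infty U)%E.
Proof.
move=> hU U0 hR rho0 LX Xneg rX wwp.
have LlX (l : R) : L (l *: X) by exact: space_scale.
have L0 : L (cstRV P 0) by exact: space_cst.
(* Without gains the market would admit arbitrage, but then all positive multiples of [X] are a.s.
   nonpositive and their utility is at most [U 0 = 0]. *)
have [Xpos|Xnpos] := pselect (0 < P [set x | (0 < X x)%R])%E; last first.
  apply: le_lt_trans (utility_lt_infty hU L0); rewrite U0.
  apply: ge_ereal_sup => _ [l /= l0 <-]; rewrite -U0.
  apply: (utility_incr hU) => //.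
  apply: filterS (ae_le0 (measurable_RV_gt X 0) Xnpos) => x /negP.
  by rewrite -leNgt -[in _ -> _]/((l *: X) x <= 0) => ?; rewrite mulr_ge0_le0// ltW.
have adm := one_stock_admissible LX Xneg Xpos.
have data : problem_data rho (one_stock_market X) 1 0.
  split=> //; rewrite /= addr0 mulr1 -[X in (_ <= X)%E]/(0%E) -rho0.
  apply: (risk_decr hR) => //; first exact: space_cst.
  by apply: aeW => x /=; exact: ler01.
apply: le_lt_trans (wwp _ adm 1 0 data).
apply: ge_ereal_sup => _ [l /= l0 <-].
pose theta : portfolio (one_stock_market X) :=
  \row_i (if i == ord0 then 1 - l else l).
have w0 : wealth0 theta = 1 by rewrite one_stock_wealth0 !mxE/= subrK.
have w1 x : wealth1 theta x = 1 + l * X x.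
  by rewrite one_stock_wealth1 w0 mxE.
have LW : L (wealth1 theta).
  by apply: space_sum => // i; apply: space_scale => //; exact: market_price1 adm i.
have le_w : le_as (l *: X) (wealth1 theta).
  by apply: aeW => x; rewrite w1 -[leLHS]/(l * X x); lra.
apply: (le_trans (utility_incr hU (LlX l) LW le_w)).
apply: ereal_sup_ubound; exists theta => //; split=> //.
apply: le_trans (rX l l0); exact: risk_decr hR _ _ (LlX l) LW le_w.
Qed.

Lemma weakly_well_posed_SLL U rho (hP : atomless P) :
  utility_functional L U -> normalized U -> sensitivity_equivalent L U ->
  risk_functional L rho -> normalized rho -> cash_convex L rho ->
  law_invariant L U \/ law_invariant L rho ->
  market_independent_weakly_well_posed L U rho ->
  SLL_utility L U \/ SLL_risk L rho.
Proof.
move=> hU U0 [se _] hR rho0 cc law wwp; apply: contrapT => /not_orP[nU nR].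
have /existsNP[Y /not_implyP[lossY nY]] : ~ ASLL L U by move=> /se.
have [Z lossZ rZ] := not_SLL_risk hR rho0 cc nR.
have LY := lossY.1; have LZ := lossZ.1.
have scale_le (l : R) X X' : 0 < l -> le_as X X' -> @le_as _ _ _ P (l *: X) (l *: X').
  by move=> l0; apply: filterS => x; apply: ler_wpM2l; exact: ltW.
have LS (l : R) X : L X -> L (l *: X) by exact: space_scale.
(* Such an [X] lets the utility in the one-stock market reach the limit superior along [Y], which is
   not below [at_infty U]. *)
suff [X [LX Xneg XY XZ]] : exists X, [/\ L X, (0 < P [set x | (X x < 0)%R])%E,
    forall l : R, 0 < l -> (U (l *: Y) <= U (l *: X))%E &
    forall l : R, 0 < l -> (rho (l *: X) <= 0)%E].
  apply: nY; apply: le_lt_trans (weakly_well_posed_sup hU U0 hR rho0 LX Xneg XZ wwp).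
  apply: (le_trans (limf_esup_pinfty_le _)).
  apply: ge_ereal_sup => _ [l /= l0 <-]; apply: (le_trans (XY l l0)).
  by apply: ereal_sup_ubound; exists l.
have max_neg X X' : (0 < P ([set x | (X x < 0)%R] `&` [set x | (X' x < 0)%R]))%E ->
    (0 < P [set x | (max_mfun X X' x < 0)%R])%E.
  congr (0 < P _)%E; apply/seteqP; split=> x /=; rewrite gt_max.
    by move=> [-> ->].
  by move=> /andP[].
have maxl X X' : le_as X (max_mfun X X').
  by apply: aeW => x; rewrite /= le_max lexx.
have maxr X X' : le_as X' (max_mfun X X').
  by apply: aeW => x; rewrite /= le_max lexx orbT.
(* The payoff belonging to the law-invariant functional is the one rearranged. Law-invariance is
   applied to its multiples, and monotonicity covers the passage to the maximum. *)
case: law => law.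
- have [Y1 [Y2 [LY1 LY2 YY1 Y12 neg]]] := overlapping_losses hL hP lossY lossZ.
  have LX : L (max_mfun Y2 Z) by exact: space_max.
  exists (max_mfun Y2 Z); split=> //; first exact: max_neg.
  + move=> l l0.
    apply: (le_trans (utility_incr hU _ _ (scale_le l _ _ l0 YY1))); [exact: LS..|].
    rewrite (law (l *: Y1) (l *: Y2)); [|exact: LS..|exact: same_law_scale].
    by apply: (utility_incr hU); [exact: LS..|exact: scale_le].
  + move=> l l0; apply: le_trans (rZ l l0).
    by apply: (risk_decr hR); [exact: LS..|exact: scale_le].
- have [Z1 [Z2 [LZ1 LZ2 ZZ1 Z12 neg]]] := overlapping_losses hL hP lossZ lossY.
  have LX : L (max_mfun Z2 Y) by exact: space_max.
  exists (max_mfun Z2 Y); split=> //; first exact: max_neg.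
  + by move=> l l0; apply: (utility_incr hU); [exact: LS..|exact: scale_le].
  + move=> l l0; apply: le_trans (rZ l l0).
    apply: (@le_trans _ _ (rho (l *: Z2))).
      by apply: (risk_decr hR); [exact: LS..|exact: scale_le].
    rewrite -(law (l *: Z1) (l *: Z2)); [|exact: LS..|exact: same_law_scale].
    by apply: (risk_decr hR); [exact: LS..|exact: scale_le].
Qed.

End PortfolioSelection.

(** * Sequential limits in the space of portfolios *)

Section Compactness.
Context (R : realType).

Lemma limn_esup_ge (u : nat -> \bar R) (b : \bar R) :
  (forall n, exists2 k, (n <= k)%N & (b <= u k)%E) -> (b <= limn_esup u)%E.
Proof.
move=> h; apply: le_ereal_inf_tmp => _ [V [n _ nV] <-].
have [k nk bk] := h n; apply: (le_trans bk).
by apply: ereal_sup_ubound; exists k => //; exact: nV.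
Qed.

Lemma limn_einf_le (u : nat -> \bar R) (b : \bar R) :
  (forall n, exists2 k, (n <= k)%N & (u k <= b)%E) -> (limn_einf u <= b)%E.
Proof.
move=> h; rewrite /limn_einf leeNl; apply: limn_esup_ge => n.
by have [k nk bk] := h n; exists k => //; rewrite leeN2.
Qed.

Lemma cvg_ge_id (f : nat -> nat) : (forall k, (k <= f k)%N) ->
  f k @[k --> \oo] --> \oo.
Proof.
move=> kf A [N _ NA]; exists N => // k /= Nk.
exact: NA (leq_trans Nk (kf k)).
Qed.

Lemma rV_coord_le n (v : 'rV[R]_n.+1) i : `|v ord0 i| <= `|v|.
Proof.
rewrite -[leRHS]/(mx_norm v) mx_normrE; apply/bigmax_geP; right => /=.
by exists (ord0, i).
Qed.

(** A cluster point exists in the compact closed ball. Indices with [k <= f k] replace a strictly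
    increasing subsequence, and the explicit rate feeds the error estimates below. *)
Lemma rV_subseq n (u : nat -> 'rV[R]_n.+1) (C : R) : (forall k, `|u k| <= C) ->
  exists l f, forall k, (k <= f k)%N /\ `|u (f k) - l| <= k.+1%:R^-1.
Proof.
move=> uC.
have cA : compact [set v : 'rV[R]_n.+1 | `|v| <= C].
  apply: bounded_closed_compact.
    exists C; split; first exact: num_real.
    by move=> M CM v /= vC; exact: le_trans vC (ltW CM).
  by apply: (@closed_comp _ _ _ [set x | x <= C]) => [v _|];
    [exact: norm_continuous | exact: closed_le].
have uA : (u @ \oo) [set v : 'rV[R]_n.+1 | `|v| <= C] by exists 0%N => // k _; exact: uC.
have [l [_ cl]] := cA (u @ \oo) _ uA.
have ex k : exists m, (k <= m)%N /\ `|u m - l| <= k.+1%:R^-1.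
  have k0 : 0 < k.+1%:R^-1 :> R by rewrite invr_gt0.
  have uk : (u @ \oo) [set u m | m in [set m | (k <= m)%N]].
    by exists k => // m /= km; exists m.
  have [_ [[m /= km <-] ball_m]] := cl _ (ball l k.+1%:R^-1) uk (nbhsx_ballx _ _ k0).
  exists m; split=> //; rewrite distrC ltW//.
  by move: ball_m; rewrite -ball_normE.
by have [f fP] := choice ex; exists l, f.
Qed.

Lemma rV_cvg_coord n (u : nat -> 'rV[R]_n.+1) l :
  (forall k, `|u k - l| <= k.+1%:R^-1) ->
  forall i, u k ord0 i @[k --> \oo] --> l ord0 i.
Proof.
move=> ul i; apply/cvgrPdist_lt => e e0.
near=> k; rewrite distrC; have := rV_coord_le (u k - l) i; rewrite !mxE.
move=> /le_lt_trans; apply; apply: (le_lt_trans (ul k)).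
by near: k; exact: (near_infty_natSinv_lt (PosNum e0)).
Unshelve. all: by end_near. Qed.

End Compactness.

(** * From sensitivity to large losses to existence of maximizers *)

Section WellPosed.
Context (d : measure_display) (T : measurableType d) (R : realType)
  (P : probability T R) (L : set {RV P >-> R}).
Implicit Types (X Y Z : {RV P >-> R}) (U rho : {RV P >-> R} -> \bar R).
Implicit Types (w Rmax : R).
Context (hL : admissible_space L).

Section Market.
Context (S : market P) (hS : admissible_market L S).
Implicit Types theta : portfolio S.

Lemma space_wealth1 theta : L (wealth1 theta).
Proof.
by apply: space_sum => // i; apply: space_scale => //; exact: market_price1 hS i.
Qed.

Lemma wealth0E theta : wealth0 theta = \sum_i theta ord0 i.
Proof. by apply: eq_bigr => i _; rewrite (market_price0 hS) mulr1. Qed.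

Lemma wealth0Z (a : R) theta : wealth0 (a *: theta : portfolio S) = a * wealth0 theta.
Proof. by rewrite !wealth0E mulr_sumr; apply: eq_bigr => i _; rewrite mxE. Qed.

Lemma wealth1Z (a : R) theta :
  wealth1 (a *: theta : portfolio S) = a *: wealth1 theta.
Proof.
by rewrite /wealth1 scaler_sumr; apply: eq_bigr => i _; rewrite mxE scalerA.
Qed.

Lemma cvg_wealth0 (u : nat -> portfolio S) theta :
  (forall i, u k ord0 i @[k --> \oo] --> theta ord0 i) ->
  wealth0 (u k) @[k --> \oo] --> wealth0 theta.
Proof.
move=> ut; rewrite wealth0E; under eq_cvg do rewrite wealth0E.
by apply: cvg_big => [|i _]; first exact: add_continuous.
Qed.

(** Convergent coordinates are bounded, so a fixed combination of the absolute asset payoffs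
    dominates. This makes both Fatou properties applicable to convergent portfolios. *)
Lemma wealth1_dominated_cvg (u : nat -> portfolio S) theta :
  (forall i, u k ord0 i @[k --> \oo] --> theta ord0 i) ->
  dominated_cvg L (fun k => wealth1 (u k)) (wealth1 theta).
Proof.
move=> ut; split.
- by move=> n; exact: space_wealth1.
- exact: space_wealth1.
- apply: aeW => x; rewrite wealth1E; under eq_cvg do rewrite wealth1E.
  apply: cvg_big => [|i _]; first exact: add_continuous.
  apply: cvgMl; exact: ut.
have bnd i : exists C, forall k, `|u k ord0 i| <= C.
  have /cvg_seq_bounded[M [_ MP]] : cvgn (fun k => u k ord0 i).
    by apply/cvg_ex; exists (theta ord0 i); exact: ut.
  exists (M + 1) => k; apply: (MP (M + 1)) => //; lra.
have [C CP] := choice bnd.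
pose Z : {RV P >-> R} := \sum_i C i *: (abs_RV (price1 i) : {mfun T >-> R}).
exists Z.
  by apply: space_sum => // i; apply: space_scale => //; apply: space_abs => //; exact: market_price1 hS i.
move=> n; apply: aeW => x; rewrite wealth1E.
rewrite /Z mfun_sum; apply: (le_trans (ler_norm_sum _ _ _)); apply: ler_sum => i _.
by rewrite -[leRHS]/(C i * abs_RV (price1 i) x) abs_RVE normrM ler_wpM2r.
Qed.

(** Without a loss, the payoff is either an arbitrage or a.s. zero; the latter contradicts
    non-redundancy. *)
Lemma zero_cost_loss theta : theta != 0 -> wealth0 theta = 0 ->
  has_loss L (wealth1 theta).
Proof.
move=> /eqP theta0 w0; split; first exact: space_wealth1.
apply: contrapT => /(ae_le0 (measurable_RV_lt _ _)) ge0.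
have [gt0|/(ae_le0 (measurable_RV_gt _ _)) le0] :=
    pselect (0 < P [set x | (0 < wealth1 theta x)%R])%E.
  apply: (market_arbitrage_free hS); exists theta; split=> //; first by rewrite w0.
  by apply: filterS ge0 => x /negP; rewrite -leNgt.
apply/theta0/(market_nonredundant hS).
apply: filterS2 ge0 le0 => x /negP; rewrite -leNgt => h1 /negP.
by rewrite -leNgt => h2; apply/eqP; rewrite eq_le h1 h2.
Qed.

(** Terminal wealth is Lipschitz in the portfolio, with the sum of the absolute asset payoffs as
    random constant. *)
Lemma wealth1_approx theta theta' (e : R) x : `|theta - theta'| <= e ->
  wealth1 theta x <= wealth1 theta' x + e * \sum_i `|price1 (m := S) i x|.
Proof.
move=> te; rewrite !wealth1E mulr_sumr -big_split/=; apply: ler_sum => i _.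
rewrite -lerBlDl -mulrBl; apply: (le_trans (ler_norm _)); rewrite normrM.
apply: ler_wpM2r => //; apply: le_trans te.
by have := rV_coord_le (theta - theta') i; rewrite !mxE.
Qed.

(** For fixed [m], the portfolio [h k] is [u k] scaled by [m / |u k|], a factor below 1 for large
    [k]. Star-shapedness bounds its risk by [m * Rmax / |u k|], and the lower Fatou property passes
    this to [m *: l]. *)
Lemma diverging_not_SLL_risk rho w Rmax (u : nat -> portfolio S) l :
  risk_functional L rho -> normalized rho -> cash_convex L rho ->
  lower_fatou L rho -> has_loss L (wealth1 (l : portfolio S)) ->
  (forall k, feasible rho w Rmax (u k)) -> (forall k, k.+1%:R < `|u k|) ->
  (forall k, `| `|u k|^-1 *: u k - l| <= k.+1%:R^-1) -> ~ SLL_risk L rho.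
Proof.
move=> hR rho0 cc lf loss uF ubig ucvg sll.
have [a a0 ha] := sll _ loss; pose m := a + 1.
have m0 : 0 < m by rewrite addr_gt0.
have := ha m; rewrite ltrDl ltr01 => /(_ isT); apply/negP; rewrite -leNgt.
pose h k : portfolio S := m *: (`|u k|^-1 *: u k).
have hcvg i : h k ord0 i @[k --> \oo] --> (m *: l) ord0 i.
  rewrite /h mxE; under eq_cvg do rewrite mxE.
  by apply: cvgMr; exact: rV_cvg_coord.
rewrite -wealth1Z; apply: (le_trans (lf _ _ (wealth1_dominated_cvg hcvg))).
apply/lee_addgt0Pr => e e0; rewrite add0e; apply: limn_einf_le => n.
(* The second bound makes the scaling factor smaller than 1, the third makes the scaled risk bound
   at most [e]. *)
pose k := maxn n (maxn (Num.bound m) (Num.bound (m * `|Rmax| / e))).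
have k1 : m < k.+1%:R.
  apply: (lt_trans (archi_boundP (ltW m0))); rewrite ltr_nat ltnS /k.
  by rewrite (leq_trans (leq_maxl _ _) (leq_maxr _ _)).
have k2 : m * `|Rmax| / e < k.+1%:R.
  apply: (lt_trans (archi_boundP _)).
    by rewrite divr_ge0 ?mulr_ge0// ltW.
  rewrite ltr_nat ltnS /k.
  by rewrite (leq_trans (leq_maxr _ _) (leq_maxr _ _)).
exists k; first exact: leq_maxl.
have uk0 : 0 < `|u k| by apply: lt_trans (ubig k).
rewrite /h scalerA wealth1Z.
apply: (le_trans (risk_scale_le rho0 cc _ _ (space_wealth1 _))).
- by rewrite divr_gt0.
- by rewrite ltr_pdivrMr// mul1r (lt_trans k1).
have [_ rk] := uF k.
apply: (@le_trans _ _ ((m / `|u k|)%:E * Rmax%:E)%E).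
  by apply: lee_wpmul2l => //; rewrite lee_fin divr_ge0// ltW.
rewrite -EFinM lee_fin mulrAC ler_pdivrMr//.
apply: (@le_trans _ _ (m * `|Rmax|)); first by rewrite ler_pM2l// ler_norm.
rewrite ltr_pdivrMr// in k2; apply: (le_trans (ltW k2)).
by rewrite mulrC ler_pM2l// ltW.
Qed.

(** SLL concerns multiples of one fixed payoff. The limit payoff is enlarged to a fixed [X n] that
    still has a loss; [|u k|] times it dominates the payoff of [u k] for large [k], contradicting
    positive utility. *)
Lemma diverging_not_SLL_utility U (u : nat -> portfolio S) l :
  utility_functional L U -> has_loss L (wealth1 (l : portfolio S)) ->
  (forall k, (0 < U (wealth1 (u k)))%E) -> (forall k, k.+1%:R < `|u k|) ->
  (forall k, `| `|u k|^-1 *: u k - l| <= k.+1%:R^-1) -> ~ SLL_utility L U.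
Proof.
move=> hU loss upos ubig ucvg sll.
pose Z : {RV P >-> R} := \sum_i (abs_RV (price1 (m := S) i) : {mfun T >-> R}).
have ZE x : Z x = \sum_i `|price1 (m := S) i x|.
  by rewrite /Z mfun_sum; apply: eq_bigr => i _; rewrite abs_RVE.
have Z0 x : 0 <= Z x by rewrite ZE sumr_ge0.
have LZ : L Z by apply: space_sum => // i; apply: space_abs => //; exact: market_price1 hS i.
pose X n : {RV P >-> R} := (n.+1%:R^-1 : R) *: (Z : {mfun T >-> R}) + wealth1 l.
have XE n x : X n x = n.+1%:R^-1 * Z x + wealth1 l x by [].
have LX n : L (X n) by apply: space_lin => //; exact: loss.1.
have [n Xn] : exists n, (0 < P [set x | (X n x < 0)%R])%E.
  apply: (@bigcup_gt0 _ _ _ P [set x | wealth1 l x < 0]).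
  - exact: measurable_RV_lt.
  - by move=> n; exact: measurable_RV_lt.
  - exact: loss.2.
  - move=> x /= lx; pose m := Num.bound (Z x / - wealth1 l x).
    suff : X m x < 0 by exists m.
    rewrite XE -ltrBrDr sub0r mulrC ltr_pdivrMr// mulrC -ltr_pdivrMr ?oppr_gt0//.
    apply: (lt_trans (archi_boundP _)); last by rewrite ltr_nat.
    by rewrite divr_ge0// oppr_ge0 ltW.
have [a a0 ha] := sll _ (conj (LX n) Xn).
(* [k >= n] puts the approximation error within the margin of [X n], and [k >= a] puts the norm of
   [u k] beyond the SLL threshold. *)
pose k := maxn n (Num.bound a).
have ak : a < `|u k|.
  apply: lt_trans (ubig k); apply: (lt_trans (archi_boundP (ltW a0))).
  by rewrite ltr_nat ltnS leq_maxr.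
have uk0 : 0 < `|u k| by exact: lt_trans ak.
have := ha _ ak; apply/negP; rewrite -leNgt; apply: (le_trans (ltW (upos k))).
apply: (utility_incr hU); [exact: space_wealth1|exact: space_scale|].
apply: aeW => x; rewrite -[leRHS]/(`|u k| * X n x).
rewrite -[u k](scalerKV (lt0r_neq0 uk0)) wealth1Z -[leLHS]/(_ * _).
rewrite scalerKV ?lt0r_neq0// ler_pM2l//; apply: (le_trans (wealth1_approx x (ucvg k))).
rewrite XE addrC lerD2r -ZE ler_wpM2r//.
by rewrite lef_pV2 ?posrE// ler_nat ltnS leq_maxl.
Qed.

(** Positive utility is what the utility case contradicts. Nothing is lost, since the riskless
    portfolio already has nonnegative utility. *)
Lemma feasible_bounded U rho w Rmax : utility_functional L U ->
  risk_functional L rho -> normalized rho -> cash_convex L rho ->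
  lower_fatou L rho -> SLL_utility L U \/ SLL_risk L rho ->
  exists C, forall theta, feasible rho w Rmax theta ->
    (0 < U (wealth1 theta))%E -> `|theta| <= C.
Proof.
move=> hU hR rho0 cc lf sll; apply: contrapT => /forallNP unb.
have ex (k : nat) : exists theta, [/\ feasible rho w Rmax theta,
    (0 < U (wealth1 theta))%E & k.+1%:R < `|theta|].
  have /existsNP[theta /not_implyP[feas /not_implyP[pos /negP big]]] := unb k.+1%:R.
  by exists theta; split=> //; rewrite ltNge.
have {ex}[u uP] := choice ex.
have u0 k : 0 < `|u k| by have [_ _] := uP k; exact: le_lt_trans.
pose eta k : portfolio S := `|u k|^-1 *: u k.
have eta1 k : `|eta k| = 1.
  by rewrite normrZ normfV normr_id mulVf// lt0r_neq0.
have [l [f fP]] := rV_subseq (fun k => (eq_ind_r (fun z => z <= 1) (lexx 1) (eta1 k))).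
(* Index 1 gives distance at most [1 / 2] from unit vectors to [l]; index 0 would only give distance
   1, which does not exclude [l = 0]. *)
have l0 : l != 0.
  apply/eqP => l0; have [_] := fP 1; rewrite l0 subr0 eta1.
  by rewrite invr_ge1 ?posrE ?unitfE//; lra.
have ubig k : k.+1%:R < `|u (f k)|.
  have [_ _] := uP (f k); apply: le_lt_trans; rewrite ler_nat ltnS.
  by have [] := fP k.
have etacvg k : `| `|u (f k)|^-1 *: u (f k) - l| <= k.+1%:R^-1 by have [] := fP k.
(* The normalized portfolios cost [w / |u k|], which tends to 0. *)
have lcost : wealth0 (l : portfolio S) = 0.
  have c1 : wealth0 (eta (f k)) @[k --> \oo] --> wealth0 (l : portfolio S).
    by apply: cvg_wealth0; exact: rV_cvg_coord.
  suff c2 : wealth0 (eta (f k)) @[k --> \oo] --> (0 : R) by exact: cvg_unique c1 c2.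
  apply: norm_cvg0; apply: (@squeeze_cvgr _ _ _ _ (cst 0) (fun k => `|w| * k.+1%:R^-1)).
  - apply: nearW => k; rewrite normr_ge0/= wealth0Z.
    have [[-> _] _ _] := uP (f k); rewrite normrM mulrC ler_wpM2l//.
    by rewrite normfV normr_id lef_pV2 ?posrE// ltW.
  - exact: cvg_cst.
  - by rewrite -(mulr0 `|w|); apply: cvgMr; exact: cvg_harmonic.
have loss := zero_cost_loss l0 lcost.
case: sll; [apply: (diverging_not_SLL_utility hU loss _ ubig etacvg)|
  apply: (diverging_not_SLL_risk (w := w) (Rmax := Rmax) hR rho0 cc lf loss _ ubig etacvg)].
  by move=> k; have [] := uP (f k).
by move=> k; have [] := uP (f k).
Qed.

(** The lower Fatou property makes the risk constraint closed under limits. *)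
Lemma feasible_lim rho w Rmax (u : nat -> portfolio S) theta :
  lower_fatou L rho ->
  (forall i, u k ord0 i @[k --> \oo] --> theta ord0 i) ->
  (forall k, feasible rho w Rmax (u k)) -> feasible rho w Rmax theta.
Proof.
move=> lf ut uF; split.
  suff cw : wealth0 (u k) @[k --> \oo] --> w by exact: cvg_unique (cvg_wealth0 ut) cw.
  by under eq_cvg do rewrite (uF _).1; exact: cvg_cst.
apply: (le_trans (lf _ _ (wealth1_dominated_cvg ut))).
by apply: limn_einf_le => n; exists n => //; exact: (uF n).2.
Qed.

(** All wealth goes into the riskless asset; the lower bound on [Rmax] in [problem_data] is exactly
    its risk constraint. *)
Lemma riskless_feasible U rho w Rmax : utility_functional L U -> normalized U ->
  risk_functional L rho -> problem_data rho S w Rmax ->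
  exists2 theta : portfolio S, feasible rho w Rmax theta & (0 <= U (wealth1 theta))%E.
Proof.
move=> hU U0 hR [w0 wR].
pose theta : portfolio S := \row_i (if i == ord0 then w else 0).
have w1 : {ae P, forall x, wealth1 theta x = w * (1 + rate S)}.
  apply: filterS (market_riskfree hS) => x rx; rewrite wealth1E (bigD1 ord0)//= big1.
    by rewrite addr0 mxE eqxx rx.
  by move=> i /negbTE i0; rewrite mxE i0 mul0r.
have Lw := space_wealth1 theta.
exists theta.
  split.
    rewrite wealth0E (bigD1 ord0)//= big1 ?addr0 ?mxE ?eqxx// => i /negbTE i0.
    by rewrite mxE i0.
  apply: le_trans wR; apply: (risk_decr hR) => //; first exact: space_cst.
  by apply: filterS w1 => x ->.
rewrite -U0; apply: (utility_incr hU) => //; first exact: space_cst.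
apply: filterS w1 => x ->; rewrite mulr_ge0 ?(ltW w0)//.
by rewrite -lerBlDl sub0r ltW// (market_rate hS).
Qed.

Lemma SLL_well_posed U rho : utility_functional L U -> normalized U ->
  upper_fatou L U -> risk_functional L rho -> normalized rho ->
  cash_convex L rho -> lower_fatou L rho -> SLL_utility L U \/ SLL_risk L rho ->
  well_posed U rho S.
Proof.
move=> hU U0 uf hR rho0 cc lf sll w Rmax data.
have [theta0 feas0 ge0] := riskless_feasible hU U0 hR data.
(* Portfolios beating the riskless one have positive utility, hence are bounded; if there are none,
   the riskless one is optimal. *)
pose better := [set theta : portfolio S | feasible rho w Rmax theta /\
  (U (wealth1 theta0) < U (wealth1 theta))%E].
have [/set0P nbetter|/negP better0] := boolP (better != set0); last first.
  exists theta0 => // theta feas; rewrite leNgt; apply/negP => lt.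
  by apply: better0; apply/set0P; exists theta.
pose V := [set U (wealth1 theta) | theta in better].
have V0 : V != set0 by apply/set0P; have [t bt] := nbetter; exists (U (wealth1 t)), t.
have [v vV vsup] := ereal_sup_seq V0.
have ex k : exists t, better t /\ U (wealth1 t) = v k.
  by have [t bt <-] := vV k; exists t.
have {ex}[u uP] := choice ex.
have [C CP] := feasible_bounded w Rmax hU hR rho0 cc lf sll.
have uC k : `|u k| <= C.
  by have [[feas lt] _] := uP k; apply: CP => //; exact: le_lt_trans lt.
have [l [f fP]] := rV_subseq uC.
have fcvg := rV_cvg_coord (fun k => (fP k).2).
have feas_l : feasible rho w Rmax (l : portfolio S).
  by apply: (feasible_lim lf fcvg) => k; have [[]] := uP (f k).
(* The values along [u (f k)] still converge to the supremum, so the upper Fatou property shows that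
   the limit portfolio attains it. *)
have supl : (ereal_sup V <= U (wealth1 (l : portfolio S)))%E.
  apply: le_trans (uf _ _ (wealth1_dominated_cvg fcvg)).
  have vf : U (wealth1 (u (f k))) @[k --> \oo] --> ereal_sup V.
    have -> : (fun k => U (wealth1 (u (f k)))) = v \o f.
      by apply/funext => k /=; have [_] := uP (f k).
    by apply: cvg_comp vsup; apply: cvg_ge_id => k; have [] := fP k.
  by rewrite is_cvg_limn_esupE; [rewrite (cvg_lim _ vf)|apply/cvg_ex; exists (ereal_sup V)].
exists l => // theta feas; apply: le_trans supl.
have inV t : better t -> (U (wealth1 t) <= ereal_sup V)%E.
  by move=> bt; apply: ereal_sup_ubound; exists t.
have [le|lt] := leP (U (wealth1 theta)) (U (wealth1 theta0)); last exact: inV.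
apply: (le_trans le); have [t bt] := nbetter.
by apply: le_trans (inV t bt); exact: ltW bt.2.
Qed.

(** The supremum is attained at a payoff in [L], where [U] stays strictly below [at_infty U]. *)
Lemma well_posed_weakly U rho : utility_functional L U ->
  well_posed U rho S -> weakly_well_posed U rho S.
Proof.
move=> hU wp w Rmax data; have [theta feas opt] := wp _ _ data.
apply: le_lt_trans (utility_lt_infty hU (space_wealth1 theta)).
by apply: ge_ereal_sup => _ [t ft <-]; exact: opt.
Qed.

End Market.
End WellPosed.

Theorem theorem4p4 (d : measure_display) (T : measurableType d) (R : realType)
    (P : probability T R) (L : set {RV P >-> R})
    (U rho : {RV P >-> R} -> \bar R)
    (hP : atomless P) (hL : admissible_space L)
    (hU : utility_functional L U) (hU0 : normalized U)
    (hUF : upper_fatou L U) (hUSE : sensitivity_equivalent L U)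
    (hR : risk_functional L rho) (hR0 : normalized rho)
    (hRcc : cash_convex L rho) (hRF : lower_fatou L rho)
    (hlaw : law_invariant L U \/ law_invariant L rho) :
  ((SLL_utility L U \/ SLL_risk L rho) <->
     market_independent_weakly_well_posed L U rho) /\
  (market_independent_weakly_well_posed L U rho <->
     market_independent_well_posed L U rho).
Proof.
(* The cycle of implications runs from (a) to (c), then to (b), and back to (a). *)
have SLL_wp : SLL_utility L U \/ SLL_risk L rho ->
    market_independent_well_posed L U rho.
  by move=> sll S hS; exact: (SLL_well_posed hL hS hU hU0 hUF hR hR0 hRcc hRF sll).
have wp_wwp : market_independent_well_posed L U rho ->
    market_independent_weakly_well_posed L U rho.
  by move=> wp S hS; apply: (well_posed_weakly hL hS hU); exact: wp.
have wwp_SLL : market_independent_weakly_well_posed L U rho ->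
    SLL_utility L U \/ SLL_risk L rho.
  exact: (weakly_well_posed_SLL hL hP hU hU0 hUSE hR hR0 hRcc hlaw).
split; split=> // h.
- exact/wp_wwp/SLL_wp.
- exact/SLL_wp/wwp_SLL.
Qed.
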